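(* Let $\beta\in\mathbb R$ and let $\varphi:\mathbb R^n\to\mathbb R^n$ be a homeomorphism such that $|\varphi^{-1}(I)|\in(0,\infty)$ for all cubes $I\subset\mathbb R^n$. Let $Q\subset\mathbb R^n$ be a cube. For $J\in\mathcal D_k(Q)$ let $J=I_k^J\subset I_{k-1}^J\subset\cdots\subset I_1^J\subset I_0^J=Q$ be the unique chain with $I_i^J\in\mathcal D_i(Q)$ for each $0\le i\le k$. Define $\lambda_Q^*:=1$ and, for $J\in\mathcal D_k(Q)$ with $k\in\mathbb N$, $$\lambda_J^*:=\left(1-\max_{0\le i\le k-1}\left(\frac{|I_i^J|}{|J|}\cdot\frac{|\varphi^{-1}(J)|}{|\varphi^{-1}(I_i^J)|}\right)^\beta\right)_+ .$$ Then $\{\lambda_J^*\}_{J\in\mathcal D(Q)}\in\mathscr T_\beta(Q)$ and $$\|\varphi\|_{\mathscr G_\beta(Q)}\le1+\sum_{k\in\mathbb N}2^{-kn\beta}\left(\sum_{J\in\mathcal D_k(Q)}\left(1-\max_{0\le i\le k-1}\left(\frac{|I_i^J|}{|J|}\cdot\frac{|\varphi^{-1}(J)|}{|\varphi^{-1}(I_i^J)|}\right)^\beta\right)_+\right),$$ where the right-hand side may be $+\infty$.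
   Context: $\mathbb N=\{1,2,\dots\}$ and $a_+=\max\{a,0\}$. All cubes in $\mathbb R^n$ have sides parallel to the coordinate axes (open, closed or half-open); $\ell(Q)$ is the side length, $|E|$ is Lebesgue measure. For a cube $Q$, $\mathcal D_0(Q)=\{Q\}$, and for $k\in\mathbb N$, $\mathcal D_k(Q)$ is the family of the $2^{kn}$ subcubes of side length $2^{-k}\ell(Q)$ obtained by $k$ successive bisections of each side of $Q$; $\mathcal D(Q)=\bigcup_{k\ge0}\mathcal D_k(Q)$. For a cube $Q$, $\mathscr T_\beta(Q)$ is the set of families $\{\lambda_I\}_{I\in\mathcal D(Q)}\subset[0,\infty)$ with $$\sum_{I\in\mathcal D(Q),\,I\supset J}\lambda_I\left(\frac{|I|}{|J|}\cdot\frac{|\varphi^{-1}(J)|}{|\varphi^{-1}(I)|}\right)^\beta\ge1\quad\text{for all }J\in\mathcal D(Q),$$ and $$\|\varphi\|_{\mathscr G_\beta(Q)}:=\inf_{\{\lambda_I\}\in\mathscr T_\beta(Q)}\sum_{I\in\mathcal D(Q)}\lambda_I\left(\frac{|I|}{|Q|}\right)^\beta\in[0,\infty].$$ *)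

(* Defs.v *)
From HB Require Import structures.
From mathcomp Require Import all_boot all_order all_algebra.
From mathcomp Require Import all_classical all_reals all_analysis.
From mathcomp Require Import lra.

Set Implicit Arguments.
Unset Strict Implicit.
Unset Printing Implicit Defensive.

Import Order.TTheory GRing.Theory Num.Theory.
Import numFieldNormedType.Exports.

Local Open Scope classical_set_scope.
Local Open Scope ring_scope.

Section lebesgue.
Context {R : realType} {n : nat}.

(* The Lebesgue outer measure of R^n, by countable covers with open boxes
   ]a_k, b_k[. On Borel sets it is Lebesgue measure, and here it is only used
   on cubes and on their preimages under homeomorphisms. *)
Definition lebesgue_rV (E : set 'rV[R]_n) : \bar R :=
  ereal_inf [set s : \bar R | exists a b : nat -> 'rV[R]_n,
    [/\ forall k i, a k 0 i <= b k 0 i,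
        E `<=` \bigcup_k [set x | forall i, a k 0 i < x 0 i < b k 0 i] &
        s = (\sum_(k <oo) (\prod_(i < n) (b k 0 i - a k 0 i))%:E)%E]].

Definition vol (E : set 'rV[R]_n) : R := fine (lebesgue_rV E).

End lebesgue.

Section cubes.
Context {R : realType} {n : nat}.

(* The two booleans tell whether the side intervals contain their left and
   right endpoints, so that the cube is open, closed or half-open. *)
Record cube := Cube {
  corner : 'rV[R]_n;
  side : R;
  side_gt0 : 0 < side;
  lclosed : bool;
  rclosed : bool }.

HB.instance Definition _ := gen_eqMixin cube.
HB.instance Definition _ := gen_choiceMixin cube.

Definition points (Q : cube) : set 'rV[R]_n :=
  [set x | forall i, x 0 i \in Interval
     (BSide (lclosed Q) (corner Q 0 i))
     (BSide (~~ rclosed Q) (corner Q 0 i + side Q))].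

Lemma half_side_gt0 (Q : cube) : 0 < side Q / 2.
Proof. by rewrite divr_gt0 ?side_gt0. Qed.

(* The parts of an open (closed, half-open) cube are taken open (closed,
   half-open of the same kind). *)
Definition bisect (Q : cube) (e : {ffun 'I_n -> bool}) : cube :=
  Cube (corner Q + \row_i ((e i)%:R * (side Q / 2))) (half_side_gt0 Q)
       (lclosed Q) (rclosed Q).

Fixpoint dyadic_gen (Q : cube) (k : nat) : set cube :=
  if k is k'.+1 then [set J | exists2 I, dyadic_gen Q k' I & exists e, J = bisect I e]
  else [set Q].

Definition dyadic (Q : cube) : set cube := \bigcup_k dyadic_gen Q k.

(* The k such that J \in D_k(Q), see generationE. *)
Definition generation (Q J : cube) : nat :=
  xget 0%N [set k | dyadic_gen Q k J].

Definition is_chain (Q J : cube) (k : nat) (c : nat -> cube) : Prop :=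
  [/\ c 0%N = Q, c k = J,
      forall i, (i <= k)%N -> dyadic_gen Q i (c i) &
      forall i, (i < k)%N -> points (c i.+1) `<=` points (c i)].

(* The cube I_i^J, see ancestor_chain and chain_unique. *)
Definition ancestor (Q J : cube) (i : nat) : cube :=
  xget Q [set I | dyadic_gen Q i I /\ points J `<=` points I].

Lemma cube_eq (I J : cube) : corner I = corner J -> side I = side J ->
  lclosed I = lclosed J -> rclosed I = rclosed J -> I = J.
Proof.
case: I J => [c s hs l r] [c' s' hs' l' r'] /= ? ? ? ?; subst.
by rewrite (bool_irrelevance hs hs').
Qed.

Lemma dyadic_genE Q k I : dyadic_gen Q k I ->
  [/\ side I = side Q / 2 ^+ k, lclosed I = lclosed Q, rclosed I = rclosed Q &
   forall i, exists m : nat, corner I 0 i = corner Q 0 i + m%:R * side I].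
Proof.
elim: k I => [|k IHk] I /=.
  move=> ->; rewrite expr0 divr1; split=> // i.
  by exists 0%N; rewrite mul0r addr0.
case=> J /IHk [sJ lJ rJ cJ] [e ->] /=; split=> //.
  by rewrite sJ exprSr invfM mulrA.
move=> i; have [m cm] := cJ i; rewrite !mxE cm.
exists (2 * m + e i)%N; rewrite natrD natrM; lra.
Qed.

Lemma generation_unique Q J k k' :
  dyadic_gen Q k J -> dyadic_gen Q k' J -> k = k'.
Proof.
have Q0 := lt0r_neq0 (side_gt0 Q).
move=> /dyadic_genE[sk _ _ _] /dyadic_genE[sk' _ _ _].
move: sk; rewrite sk' => h; have := invr_inj (mulfI Q0 h).
by rewrite -!natrX => /esym /eqP; rewrite eqr_nat eqn_exp2l// => /eqP.
Qed.

Lemma generationE Q J k : dyadic_gen Q k J -> generation Q J = k.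
Proof.
move=> QJ; rewrite /generation; case: xgetP => [k' _ /= QJ'|/(_ k)//].
exact: generation_unique QJ' QJ.
Qed.

Lemma points_inner (J : cube) (t : R) : 0 < t < 1 ->
  points J (corner J + const_mx (t * side J)).
Proof.
move=> /andP[t0 t1] i; have s0 := side_gt0 J.
have ts0 : 0 < t * side J by rewrite mulr_gt0.
have ts1 : t * side J < side J by rewrite gtr_pMl.
rewrite !mxE in_itv /= lteifD2l.
by rewrite -[X in X < _ ?<= if _]addr0 lteifD2l !lteifS.
Qed.

Lemma points_closed (I : cube) x i : points I x ->
  corner I 0 i <= x 0 i <= corner I 0 i + side I.
Proof. by move=> /(_ i); rewrite in_itv /= => /andP[/lteifW-> /lteifW->]. Qed.

Lemma ancestor_unique Q J k I I' : dyadic_gen Q k I -> dyadic_gen Q k I' ->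
  points J `<=` points I -> points J `<=` points I' -> I = I'.
Proof.
move=> /dyadic_genE[sI lI rI cI] /dyadic_genE[sI' lI' rI' cI'] JI JI'.
have sII : side I' = side I by rewrite sI sI'.
apply: cube_eq; rewrite ?lI ?rI //.
apply/rowP => i; have [m hm] := cI i; have [m' hm'] := cI' i.
have s0 := side_gt0 I; have t0 := side_gt0 J.
have h1 : 0 < (1/3 : R) < 1 by apply/andP; split; lra.
have h2 : 0 < (2/3 : R) < 1 by apply/andP; split; lra.
have /andP[a1 b1] := points_closed i (JI _ (points_inner J h1)).
have /andP[a2 b2] := points_closed i (JI _ (points_inner J h2)).
have /andP[a3 b3] := points_closed i (JI' _ (points_inner J h1)).
have /andP[a4 b4] := points_closed i (JI' _ (points_inner J h2)).
rewrite !mxE in a1 b1 a2 b2 a3 b3 a4 b4.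
rewrite sII in hm' b3 b4.
have key (p q : nat) : (p < q)%N -> p%:R * side I + side I <= q%:R * side I.
  move=> pq; rewrite -[X in _ + X]mul1r -mulrDl natr1 ler_pM2r // ler_nat //.
case: (ltngtP m m') => [/key h|/key h|mm].
- exfalso; lra.
- exfalso; lra.
by rewrite hm hm' mm.
Qed.

Lemma bisect_sub I e : points (bisect I e) `<=` points I.
Proof.
move=> x xI i; have := xI i; have s0 := side_gt0 I.
rewrite !mxE !in_itv /= => /andP[h1 h2].
have e0 : 0 <= (e i)%:R * (side I / 2) by case: (e i); rewrite ?mul1r ?mul0r; lra.
have e1 : (e i)%:R * (side I / 2) + side I / 2 <= side I.
  by case: (e i); rewrite ?mul1r ?mul0r; lra.
apply/andP; split.
  by move: h1; case: (lclosed I) => /=; lra.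
by move: h2; case: (rclosed I) => /=; lra.
Qed.

Lemma ancestor_exists Q J k i : dyadic_gen Q k J -> (i <= k)%N ->
  exists I, dyadic_gen Q i I /\ points J `<=` points I.
Proof.
elim: k J => [|k IHk] J; first by move=> QJ; rewrite leqn0 => /eqP->; exists J; split.
move=> QJ; rewrite leq_eqVlt => /predU1P[->|]; first by exists J; split.
have [I QI [e ->]] := QJ; rewrite ltnS => /(IHk _ QI)[I' [QI' II']].
by exists I'; split=> //; exact: subset_trans (@bisect_sub I e) II'.
Qed.

Lemma ancestorP Q J k i : dyadic_gen Q k J -> (i <= k)%N ->
  dyadic_gen Q i (ancestor Q J i) /\ points J `<=` points (ancestor Q J i).
Proof.
move=> QJ ik; have [I hI] := ancestor_exists QJ ik.
by rewrite /ancestor; case: xgetP => [I' _ //|/(_ I)].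
Qed.

Lemma ancestorE Q J k i I : dyadic_gen Q k J -> (i <= k)%N ->
  dyadic_gen Q i I -> points J `<=` points I -> ancestor Q J i = I.
Proof.
move=> QJ ik QI JI; have [QA JA] := ancestorP QJ ik.
exact: ancestor_unique QA QI JA JI.
Qed.

Lemma ancestor_chain Q J k : dyadic_gen Q k J -> is_chain Q J k (ancestor Q J).
Proof.
move=> QJ; split.
- by have [] := ancestorP QJ (leq0n k).
- exact: (ancestorE QJ (leqnn k) QJ).
- by move=> i /(ancestorP QJ)[].
move=> i ik; have [QA JA] := ancestorP QJ ik.
have [I QI [e AI]] := QA; rewrite AI in JA *.
rewrite (ancestorE QJ (ltnW ik) QI); first exact: bisect_sub.
exact: subset_trans JA (@bisect_sub I e).
Qed.

Lemma chain_unique Q J k c : dyadic_gen Q k J -> is_chain Q J k c ->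
  forall i, (i <= k)%N -> c i = ancestor Q J i.
Proof.
move=> QJ [_ ck Qc cS] i ik; apply/esym/(ancestorE QJ ik (Qc _ ik)).
have H d : (d <= k)%N -> points J `<=` points (c (k - d)%N).
  elim: d => [|d IHd] dk; first by rewrite subn0 ck.
  apply: subset_trans (IHd (ltnW dk)) _.
  have -> : (k - d = (k - d.+1).+1)%N by rewrite subnSK.
  by apply: cS; rewrite subnS prednK ?subn_gt0 // leq_subr.
by have := H (k - i)%N (leq_subr _ _); rewrite subKn.
Qed.

End cubes.
Arguments cube : clear implicits.

Section Gbeta_norm.
Context {R : realType} {n : nat}.
Implicit Types (f : 'rV[R]_n -> 'rV[R]_n) (beta : R) (Q I J : cube R n).

Definition homeomorphism f : Prop :=
  continuous f /\ exists g, [/\ continuous g, cancel f g & cancel g f].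

Definition vol_ratio f I J : R :=
  (vol (points I) / vol (points J)) *
  (vol (f @^-1` points J) / vol (f @^-1` points I)).

(* A family indexed by D(Q) is a function on all cubes of which only the
   values on D(Q) matter. *)
Definition admissible f beta Q (lam : cube R n -> R) : Prop :=
  (forall I, dyadic Q I -> 0 <= lam I) /\
  (forall J, dyadic Q J ->
    1 <= \esum_(I in [set I | dyadic Q I /\ points J `<=` points I])
           (lam I * vol_ratio f I J `^ beta)%:E)%E.

Definition Gbeta_norm f beta Q : \bar R :=
  ereal_inf [set (\esum_(I in dyadic Q)
    (lam I * (vol (points I) / vol (points Q)) `^ beta)%:E)%E
    | lam in [set lam | admissible f beta Q lam]].

(* Powers `^ are nonnegative, so for k > 0 the default value 0 of the iterated
   maximum does not affect it. *)
Definition gap f beta Q (k : nat) J : R :=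
  Num.max (1 - \big[Num.max/0]_(i < k) vol_ratio f (ancestor Q J i) J `^ beta) 0.

Definition lambda_star f beta Q J : R :=
  let k := generation Q J in if k == 0%N then 1 else gap f beta Q k J.

End Gbeta_norm.

(* Main.v *)
Require Import Defs.
From mathcomp Require Import all_boot all_order all_algebra.
From mathcomp Require Import all_classical all_reals all_analysis.
From mathcomp Require Import ring lra.

Set Implicit Arguments.
Unset Strict Implicit.
Unset Printing Implicit Defensive.

Import Order.TTheory GRing.Theory Num.Theory.
Import numFieldNormedType.Exports.

Local Open Scope classical_set_scope.
Local Open Scope ring_scope.

(** The ratios r(I,J) = [vol_ratio phi I J] are multiplicative, r(I,K) = r(I,J) r(J,K), and r(I,I) =
    1. Hence the covering sum S(J) of a nonnegative family satisfies S(J) >= lambda_J + r(I,J)^beta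
    S(I) for every proper ancestor I of J. If I attains the maximum m in the definition of [gap],
    then lambda_J >= 1 - m, and S(I) >= 1 by induction on the generation, so S(J) >= 1: this is
    [lambda_star_covering]. The infimum is thus at most the cost of this family, which
    [esum_lambda_star] computes generation by generation. The measure theory needed is that cubes
    have positive finite measure scaling as the n-th power of the side. *)

Lemma esumZl (R : realType) (T : choiceType) (I : set T) (r : R)
    (a : T -> \bar R) : 0 < r -> (forall i, 0 <= a i)%E ->
  (\esum_(i in I) (r%:E * a i) = r%:E * \esum_(i in I) a i)%E.
Proof.
move=> r0 a0; rewrite /esum -ereal_sup_pZl//; congr ereal_sup.
apply/seteqP; split => x /= [].
  move=> X IX <-; exists (\sum_(i \in X) a i)%E; first by exists X.
  by rewrite ge0_mule_fsumr.
by move=> _ [X IX <-] <-; exists X => //; rewrite ge0_mule_fsumr.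
Qed.

Lemma subset_esum (R : realType) (T : choiceType) (A B : set T)
    (a : T -> \bar R) : A `<=` B -> (forall i, B i -> 0 <= a i)%E ->
  (\esum_(i in A) a i <= \esum_(i in B) a i)%E.
Proof.
move=> AB a0; rewrite (esumID A _ _ a0) (_ : B `&` A = A).
  by rewrite leeDl// esum_ge0// => i [/a0].
by rewrite setIC; exact/setIidPl.
Qed.

(** * Scaling of the measure of cubes, and continuous images of cubes *)

Section lebesgue_cubes.
Context {R : realType} {n : nat}.
Implicit Types (E F : set 'rV[R]_n) (I J Q : cube R n).

Lemma le_lebesgue_rV E F : E `<=` F -> (lebesgue_rV E <= lebesgue_rV F)%E.
Proof.
move=> EF; apply: ereal_inf_le_tmp => s [a [b [ab Fab ->]]].
by exists a, b; split => //; exact: subset_trans Fab.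
Qed.

(** A homothety maps a cover by boxes to a cover by boxes whose volumes are multiplied by t^n. For
    cubes of the same kind, the reverse inequality comes from exchanging the two cubes in
    [lebesgue_rV_cube]. *)
Lemma lebesgue_rV_homothety_le E (c : 'rV[R]_n) (t : R) : 0 < t ->
  (lebesgue_rV [set (c + t *: x)%R | x in E] <= (t ^+ n)%:E * lebesgue_rV E)%E.
Proof.
move=> t0; rewrite -lee_pdivrMl ?exprn_gt0//.
apply: le_ereal_inf_tmp => s [a [b [ab Eab ->]]].
rewrite lee_pdivrMl ?exprn_gt0//; apply: ge_ereal_inf => /=.
exists (\sum_(k <oo) (\prod_(i < n) ((c + t *: b k) 0 i - (c + t *: a k) 0 i)%R)%:E)%E.
  exists (fun k => c + t *: a k), (fun k => c + t *: b k); split=> //.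
    by move=> k i; rewrite !mxE lerD2l ler_pM2l.
  move=> _ [x /Eab[k _ xk] <-]; exists k => // i.
  by rewrite !mxE !ltrD2l !ltr_pM2l.
rewrite -nneseriesZl; last first.
  by move=> k _; rewrite lee_fin prodr_ge0// => i _; rewrite subr_ge0.
rewrite le_eqVlt; apply/orP; left; apply/eqP/eq_eseriesr => k _.
rewrite -EFinM; congr EFin.
have -> : t ^+ n = \prod_(i < n) t by rewrite prodr_const card_ord.
rewrite -big_split/=.
by apply: eq_bigr => i _; rewrite !mxE; ring.
Qed.

Lemma lebesgue_rV_cube_le I J : lclosed I = lclosed J -> rclosed I = rclosed J ->
  (lebesgue_rV (points J) <=
   ((side J / side I) ^+ n)%:E * lebesgue_rV (points I))%E.
Proof.
move=> lIJ rIJ; have sI := side_gt0 I; have sJ := side_gt0 J.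
set t := side J / side I; have t0 : 0 < t by rewrite divr_gt0.
apply: le_trans (lebesgue_rV_homothety_le _ (corner J - t *: corner I) t0).
apply: le_lebesgue_rV => y yJ.
exists (corner I + t^-1 *: (y - corner J)); last first.
  rewrite scalerDr scalerA divff ?lt0r_neq0// scale1r.
  by apply/rowP => i; rewrite !mxE; ring.
move=> i; have := yJ i; rewrite !mxE !in_itv/= lIJ rIJ.
have e1 : side I = t^-1 * side J by rewrite invf_div divfK ?lt0r_neq0.
have t1 : 0 < t^-1 by rewrite invr_gt0.
move=> /andP[yl yr]; apply/andP; split.
  move: yl; case: (lclosed J) => /=.
    by rewrite lerDl pmulr_rge0// subr_ge0.
  by rewrite ltrDl pmulr_rgt0// subr_gt0.
move: yr; case: (rclosed J) => /=.
  by rewrite e1 lerD2l ler_pM2l// lerBlDl.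
by rewrite e1 ltrD2l ltr_pM2l// ltrBlDl.
Qed.

Lemma lebesgue_rV_cube I J : lclosed I = lclosed J -> rclosed I = rclosed J ->
  lebesgue_rV (points J) =
  (((side J / side I) ^+ n)%:E * lebesgue_rV (points I))%E.
Proof.
move=> lIJ rIJ; apply/eqP; rewrite eq_le lebesgue_rV_cube_le//=.
have sI := side_gt0 I; have sJ := side_gt0 J.
rewrite -lee_pdivlMl ?exprn_gt0 ?divr_gt0// -exprVn invf_div.
exact: lebesgue_rV_cube_le.
Qed.

(** The closed cube is compact, so its image is bounded. The kind of [B] is left free because
    measures are compared only between cubes of the same kind. *)
Lemma continuous_image_sub_cube (f : 'rV[R]_n -> 'rV[R]_n) Q (l r : bool) :
  continuous f ->
  exists B : cube R n, [/\ lclosed B = l, rclosed B = r & f @` points Q `<=` points B].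
Proof.
move=> cf.
pose K := [set x : 'rV[R]_n |
  forall i, `[corner Q 0 i, corner Q 0 i + side Q]%classic (x ord0 i)].
have cK : compact K.
  apply: (@rV_compact _ _ (fun i => `[corner Q 0 i, corner Q 0 i + side Q]%classic)).
  by move=> i; exact: segment_compact.
have QK : points Q `<=` K by move=> x /points_closed xQ i /=; rewrite in_itv/= xQ.
have /compact_bounded := continuous_compact (continuous_subspaceT cf) cK.
move=> /pinfty_ex_gt0[M M0 fM].
(* The cube from -(M+1) to M+1 leaves a margin around [-M, M], so its endpoints do not matter. *)
have s0 : 0 < 2 * M + 2 by lra.
exists (Cube (const_mx (- (M + 1))) s0 l r); split => // _ [x /QK Kx <-] i.
have /fM {}fM : (f @` K) (f x) by exists x.
have : `|f x 0 i| <= M.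
  apply: le_trans fM.
  rewrite [leRHS]/Num.norm /= mx_normrE; apply/bigmax_geP; right => /=.
  by exists (ord0, i).
rewrite ler_norml => /andP[h1 h2].
rewrite mxE in_itv/=; apply/andP; split; apply: lteifS; lra.
Qed.

End lebesgue_cubes.

(** * Inclusions between dyadic cubes of different generations *)

Section cubes_geometry.
Context {R : realType} {n : nat}.
Implicit Types (I J Q : cube R n).

(** Two inner points of [I] are 3/4 of its side apart in one coordinate. The factor 1/2 suffices,
    since each generation halves the side. *)
Lemma sub_points_side I J : (0 < n)%N -> points I `<=` points J ->
  side I / 2 < side J.
Proof.
move=> n0 IJ; have sI := side_gt0 I; have sJ := side_gt0 J.
have h1 : 0 < (1/8 : R) < 1 by apply/andP; split; lra.
have h2 : 0 < (7/8 : R) < 1 by apply/andP; split; lra.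
have /andP[a1 _] := points_closed (Ordinal n0) (IJ _ (points_inner I h1)).
have /andP[_ b2] := points_closed (Ordinal n0) (IJ _ (points_inner I h2)).
by rewrite !mxE in a1 b2; lra.
Qed.

Lemma dyadic_gen_subN Q I J i k : (0 < n)%N -> (i < k)%N ->
  dyadic_gen Q i I -> dyadic_gen Q k J -> ~ points I `<=` points J.
Proof.
move=> n0 ik /dyadic_genE[sI _ _ _] /dyadic_genE[sJ _ _ _] /(sub_points_side n0).
apply/negP; rewrite -leNgt sI sJ -mulrA -invfM -exprSr.
rewrite ler_pM2l ?side_gt0// lef_pV2 ?posrE ?exprn_gt0//.
by rewrite ler_eXn2l// ltr1n.
Qed.

Lemma trivIset_dyadic_gen Q : trivIset setT (dyadic_gen Q).
Proof. by move=> i j _ _ [J [Ji Jj]]; exact: generation_unique Ji Jj. Qed.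

End cubes_geometry.

(** * Volume ratios, admissibility of the family and its cost *)

Section homeomorphism.
Context {R : realType} {n : nat} (f : 'rV[R]_n -> 'rV[R]_n)
  (f_homeo : homeomorphism f)
  (f_vol : forall I : cube R n,
    (0 < lebesgue_rV (f @^-1` points I) < +oo)%E).
Implicit Types (I J K Q : cube R n) (beta : R).

(* Lebesgue measure of cubes is not computed: the preimage of [Q] is contained
   in a dilate of [Q], which makes the measure of [Q] positive, and [Q] is
   contained in the preimage of a cube, which makes it finite. *)
Lemma lebesgue_rV_cube_gt0_lty Q : (0 < lebesgue_rV (points Q) < +oo)%E.
Proof.
have [cf [g [cg fK gK]]] := f_homeo; apply/andP; split; last first.
  have [B [_ _ fQB]] := continuous_image_sub_cube Q false false cf.
  have /andP[_] := f_vol B; apply: le_lt_trans.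
  by apply: le_lebesgue_rV => x Qx; apply: fQB; exists x.
have [B [lB rB gQB]] := continuous_image_sub_cube Q (lclosed Q) (rclosed Q) cg.
have /andP[+ _] := f_vol Q; rewrite !ltNge; apply: contraNN => Q0.
apply: le_trans (_ : lebesgue_rV (points B) <= 0)%E.
  by apply: le_lebesgue_rV => x Qx; apply: gQB; exists (f x).
rewrite (lebesgue_rV_cube (esym lB) (esym rB)) mule_ge0_le0// lee_fin.
by rewrite exprn_ge0// divr_ge0// ltW// side_gt0.
Qed.

Lemma vol_cube_gt0 Q : 0 < vol (points Q).
Proof. by rewrite fine_gt0// lebesgue_rV_cube_gt0_lty. Qed.

Lemma vol_preimage_gt0 Q : 0 < vol (f @^-1` points Q).
Proof. by rewrite fine_gt0. Qed.

Lemma vol_dyadic_gen Q J k : dyadic_gen Q k J ->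
  vol (points J) / vol (points Q) = (2 ^+ (k * n))^-1.
Proof.
move=> /dyadic_genE[sJ lJ rJ _].
rewrite /vol (lebesgue_rV_cube (esym lJ) (esym rJ)) fineM//; last first.
  by rewrite ge0_fin_numE ?ltW//; have /andP[] := lebesgue_rV_cube_gt0_lty Q.
rewrite /= mulfK ?lt0r_neq0 ?vol_cube_gt0//.
by rewrite sJ mulrAC divff ?lt0r_neq0 ?side_gt0// mul1r exprVn exprM.
Qed.

Lemma vol_ratio_ge0 I J : 0 <= vol_ratio f I J.
Proof. by rewrite mulr_ge0// divr_ge0// ltW// ?vol_cube_gt0// vol_preimage_gt0. Qed.

Lemma vol_ratio_refl I : vol_ratio f I I = 1.
Proof. by rewrite /vol_ratio !divff ?mulr1 ?lt0r_neq0 ?vol_cube_gt0 ?vol_preimage_gt0. Qed.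

Lemma vol_ratio_trans J I K :
  vol_ratio f I K = vol_ratio f I J * vol_ratio f J K.
Proof.
rewrite /vol_ratio; field.
by rewrite !lt0r_neq0// ?vol_cube_gt0 ?vol_preimage_gt0.
Qed.

Lemma gap_ge0 beta Q k J : 0 <= gap f beta Q k J.
Proof. by rewrite le_max lexx orbT. Qed.

Lemma lambda_star_ge0 beta Q J : 0 <= lambda_star f beta Q J.
Proof. by rewrite /lambda_star; case: ifP => // _; exact: gap_ge0. Qed.

(* With [I_i] an ancestor of [J] that attains the maximum [m], multiplicativity
   of the ratios bounds the sum over the cubes containing [I_i] below by [m]
   (induction), and the term of [J] itself is at least [1 - m]. *)
Lemma lambda_star_covering beta Q J : (0 < n)%N -> dyadic Q J ->
  (1 <= \esum_(I in [set I | dyadic Q I /\ points J `<=` points I])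
          (lambda_star f beta Q I * vol_ratio f I J `^ beta)%:E)%E.
Proof.
move=> n0 [k _ QJ]; elim/ltn_ind: k J QJ => k IHk J QJ.
set A := [set I | _]; set F := fun I => _.
have F0 I : (0 <= F I)%E by rewrite lee_fin mulr_ge0 ?lambda_star_ge0 ?powR_ge0.
have AJ : A J by split => //; exists k.
rewrite (esumID [set J]); last by move=> I _; exact: F0.
rewrite (_ : A `&` [set J] = [set J]); last first.
  by rewrite setIC; apply/setIidPl => _ ->.
rewrite esum_set1; last exact: F0.
rewrite vol_ratio_refl powR1 mulr1 /lambda_star (generationE QJ).
case: ifPn => [_|k0]; first by rewrite leeDl// esum_ge0// => I _; exact: F0.
case: k k0 => // k _ in IHk QJ *.
pose r (i : 'I_k.+1) := vol_ratio f (ancestor Q J i) J `^ beta.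
(* The maximum is attained because its default value 0 is below the nonnegative powers. *)
have [i _ Mi] : {i | i \in predT & \big[Num.max/0]_(i < k.+1) r i = r i}.
  by apply: (eq_bigmax ord0) => // i _; exact: powR_ge0.
pose I := ancestor Q J i; set m := r i in Mi.
have [QI JI] := ancestorP QJ (ltnW (ltn_ord i)).
apply: (@le_trans _ _ ((1 - m)%:E + m%:E)%E).
  by rewrite -EFinD subrK.
apply: leeD; first by rewrite lee_fin /gap Mi le_max lexx.
apply: (@le_trans _ _
  (\esum_(K in [set K | dyadic Q K /\ points I `<=` points K]) F K)%E); last first.
  apply: subset_esum => [K [QK IK]|K _]; last exact: F0.
  split.
    by split => //; exact: subset_trans IK.
  (* The term of [J], already split off, is not counted twice: [J] is too small to contain its
     proper ancestor [I]. *)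
  by move=> /= KJ; rewrite KJ in IK; exact: dyadic_gen_subN n0 (ltn_ord i) QI QJ IK.
have [m0|m0] := eqVneq m 0; first by rewrite m0 esum_ge0// => K _; exact: F0.
have {}m0 : 0 < m by rewrite lt_neqAle eq_sym m0 powR_ge0.
rewrite -[leLHS]mule1; apply: le_trans (_ : _ <= m%:E * \esum_(K in _) _)%E _.
  by rewrite lee_pmul2l//; exact: IHk (ltn_ord i) _ QI.
have G0 K : (0 <= (lambda_star f beta Q K * vol_ratio f K I `^ beta)%:E)%E.
  by rewrite lee_fin mulr_ge0 ?lambda_star_ge0 ?powR_ge0.
rewrite -(esumZl _ m0 G0).
apply: le_esum => K _; rewrite /F (vol_ratio_trans I K J).
rewrite powRM; [|exact: vol_ratio_ge0..].
rewrite -EFinM lee_fin -/(r i) -/m mulrA [m * _]mulrC.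
exact: lexx.
Qed.

Lemma lambda_star_admissible beta Q : (0 < n)%N ->
  admissible f beta Q (lambda_star f beta Q).
Proof.
move=> n0; split=> [I _|J]; first exact: lambda_star_ge0.
exact: lambda_star_covering.
Qed.

(** The generations are disjoint, so the sum may be grouped by k. Generation 0 gives 1, and |J|/|Q|
    = 2^(-kn) is constant on generation k. *)
Lemma esum_lambda_star beta Q :
  (\esum_(I in dyadic Q)
    (lambda_star f beta Q I * (vol (points I) / vol (points Q)) `^ beta)%:E =
   1 + \sum_(1 <= k <oo)
         (2 `^ (- (k%:R * n%:R * beta)))%:E *
         \esum_(J in dyadic_gen Q k) (gap f beta Q k J)%:E)%E.
Proof.
rewrite /dyadic nneseries_sum_bigcup; first last.
- by move=> I; rewrite lee_fin mulr_ge0 ?lambda_star_ge0 ?powR_ge0.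
- exact: trivIset_dyadic_gen.
rewrite nneseries_recl//; last first.
  by move=> k _; apply: esum_ge0 => I _; rewrite lee_fin mulr_ge0 ?lambda_star_ge0 ?powR_ge0.
congr (_ + _)%E.
  rewrite esum_set1; last by rewrite lee_fin mulr_ge0 ?lambda_star_ge0 ?powR_ge0.
  rewrite divff ?lt0r_neq0 ?vol_cube_gt0// powR1 mulr1.
  by rewrite /lambda_star (generationE (k := 0)).
(* The bound 1 <= k is made available termwise, since [lambda_star] equals [gap] only in positive
   generations. *)
rewrite [LHS]eseries_cond [RHS]eseries_cond; apply: eq_eseriesr => k /andP[_ k0].
rewrite -esumZl ?powR_gt0//; last by move=> J; rewrite lee_fin gap_ge0.
apply: eq_esum => J QJ; rewrite -EFinM mulrC /lambda_star (generationE QJ).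
rewrite (vol_dyadic_gen QJ) gtn_eqF//; congr EFin; congr *%R.
by rewrite -powR_invn// natrM -powRrM mulNr.
Qed.

End homeomorphism.

Theorem theorem3p15 (R : realType) (n : nat) (n_gt0 : (0 < n)%N) (beta : R)
    (phi : 'rV[R]_n -> 'rV[R]_n) (phi_homeo : homeomorphism phi)
    (phi_vol : forall I : cube R n,
      (0 < lebesgue_rV (phi @^-1` points I) < +oo)%E)
    (Q : cube R n) :
  admissible phi beta Q (lambda_star phi beta Q) /\
  (Gbeta_norm phi beta Q <=
    1 + \sum_(1 <= k <oo)
          (2 `^ (- (k%:R * n%:R * beta)))%:E *
          \esum_(J in dyadic_gen Q k) (gap phi beta Q k J)%:E)%E.
Proof.
have adm := lambda_star_admissible phi_homeo phi_vol beta Q n_gt0.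
split => //; rewrite -(esum_lambda_star phi_homeo phi_vol).
by apply: ereal_inf_lbound; exists (lambda_star phi beta Q).
Qed.
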